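(* Let $R$ be a nonzero ring. Then $R$ is both semi-local and $\sqrt{\Delta}$-fine if and only if $R$ is a simple Artinian ring.
   Context: Rings are associative with identity, not necessarily commutative. For a ring $R$, $U(R)$ is its group of units and $J(R)$ its Jacobson radical. Define $\Delta(R) = \{a \in R : 1 - ua \in U(R) \text{ for every } u \in U(R)\}$ and $\sqrt{\Delta(R)} = \{x \in R : x^m \in \Delta(R) \text{ for some integer } m \ge 1\}$. A nonzero element $r \in R$ is called $\sqrt{\Delta}$-fine if $r = u + a$ for some $u \in U(R)$ and $a \in \sqrt{\Delta(R)}$. The ring $R$ is called $\sqrt{\Delta}$-fine if every nonzero element of $R$ is $\sqrt{\Delta}$-fine. A ring $R$ is semi-local if $R/J(R)$ is a semisimple Artinian ring. *)

(* Defs.v *)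
From HB Require Import structures.
From mathcomp Require Import all_boot all_algebra generic_quotient ring_quotient.
From mathcomp Require Import boolp classical_sets.

Set Implicit Arguments.
Unset Strict Implicit.
Unset Printing Implicit Defensive.

Import GRing.Theory.

Local Open Scope classical_set_scope.
Local Open Scope quotient_scope.
Local Open Scope ring_scope.

(* [pzRingType] is the type of associative, not necessarily commutative rings
   with identity, the zero ring being allowed; [nzRingType] adds [1 != 0]. *)

(* Two-sided inverse; unlike [GRing.unit], this does not require the ring to
   carry a boolean test for units and a total inverse function. *)
Definition is_unit (R : pzRingType) (x : R) : Prop :=
  exists y : R, y * x = 1 /\ x * y = 1.

Section Ideals.
Variable R : pzRingType.
Implicit Types (I K M : set R) (a x y : R).

Definition left_ideal I : Prop :=
  [/\ I 0, forall x y, I x -> I y -> I (x + y) & forall a x, I x -> I (a * x)].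

Definition right_ideal I : Prop :=
  [/\ I 0, forall x y, I x -> I y -> I (x + y) & forall a x, I x -> I (x * a)].

Definition two_sided_ideal I : Prop := left_ideal I /\ right_ideal I.

Definition maximal_left_ideal M : Prop :=
  [/\ left_ideal M, M <> setT &
      forall I, left_ideal I -> M `<=` I -> I = M \/ I = setT].

(* When there is no maximal left ideal, i.e. in the zero ring, this is the
   whole ring. *)
Definition jacobson : set R :=
  [set x | forall M, maximal_left_ideal M -> M x].

End Ideals.

Arguments jacobson : clear implicits.

Section JacobsonIdeal.
Variable R : pzRingType.
Implicit Types (I M : set R) (a x y : R).

Lemma left_idealN I x : left_ideal I -> I x -> I (- x).
Proof. by move=> [_ _ IM] Ix; rewrite -mulN1r; exact: IM. Qed.

Lemma jacobson_left_ideal : left_ideal (jacobson R).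
Proof.
split.
- by move=> M [[]].
- by move=> x y Jx Jy M maxM; case: (maxM) => -[_ MD _] _ _; apply: MD; [exact: Jx|exact: Jy].
- by move=> a x Jx M maxM; case: (maxM) => -[_ _ MM] _ _; apply: MM; exact: Jx.
Qed.

(* The preimage of a maximal left ideal under right multiplication is the
   whole ring or a maximal left ideal. *)
Lemma maximal_left_ideal_preim M a : maximal_left_ideal M -> ~ M a ->
  maximal_left_ideal [set x | M (x * a)].
Proof.
move=> [lM _ maxM] nMa; case: (lM) => M0 MD MM; split.
- split=> /=.
  + by rewrite mul0r.
  + by move=> x y Mx My; rewrite mulrDl; exact: MD.
  + by move=> b x Mx; rewrite -mulrA; exact: MM.
- by move/seteqP => -[_ /(_ 1 Logic.I)] /=; rewrite mul1r.
move=> I lI sub; case: (lI) => I0 ID IM.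
pose K : set R := [set z | exists y x, [/\ M y, I x & z = y + x * a]].
have lK : left_ideal K.
  split.
  - by exists 0, 0; split=> //; rewrite mul0r addr0.
  - move=> _ _ [y1 [x1 [My1 Ix1 ->]]] [y2 [x2 [My2 Ix2 ->]]].
    exists (y1 + y2), (x1 + x2); split; [exact: MD|exact: ID|].
    by rewrite mulrDl addrACA.
  - move=> b _ [y [x [My Ix ->]]]; exists (b * y), (b * x).
    by split; [exact: MM|exact: IM|rewrite mulrDr mulrA].
have MK : M `<=` K by move=> y My; exists y, 0; split=> //; rewrite mul0r addr0.
case: (maxM K lK MK) => eK; [left|right]; apply/seteqP; split=> // x.
- move=> Ix /=; rewrite -eK; exists 0, x.
  by split=> //; rewrite add0r.
- move=> _; have : K (x * a) by rewrite eK.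
  case=> y [z [My Iz E]].
  rewrite -(subrK z x); apply: ID => //; apply: sub => /=.
  by rewrite mulrBl E addrK.
Qed.

Lemma jacobson_two_sided : two_sided_ideal (jacobson R).
Proof.
split; first exact: jacobson_left_ideal.
case: jacobson_left_ideal => J0 JD _; split=> // a x Jx M maxM.
have [Ma|nMa] := pselect (M a).
  by case: maxM => -[_ _ MM] _ _; exact: MM.
exact: (Jx _ (maximal_left_ideal_preim maxM nMa)).
Qed.

(* [Quotient.quot] of ring_quotient expects a boolean predicate closed under
   the group operations; it provides the additive group R/J(R). *)
Definition jacobson_pred (x : R) : bool := `[< jacobson R x >].

Fact jacobson_zmod_closed : zmod_closed jacobson_pred.
Proof.
case: jacobson_left_ideal => J0 JD _.
split=> [|x y]; rewrite /in_mem /=; first exact/asboolP.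
move=> /asboolP Jx /asboolP Jy; apply/asboolP; apply: (JD _ _ Jx).
exact: (left_idealN jacobson_left_ideal Jy).
Qed.

HB.instance Definition _ :=
  GRing.isZmodClosed.Build R jacobson_pred jacobson_zmod_closed.

Definition jacobson_quot := Quotient.quot (GRing.ZmodClosed.clone _ jacobson_pred _).

HB.instance Definition _ := GRing.Zmodule.on jacobson_quot.
HB.instance Definition _ := EqQuotient.on jacobson_quot.

(* ring_quotient only multiplies in quotients of commutative rings, hence the
   following ring structure on R/J(R). *)
Definition jq_one : jacobson_quot := lift_cst jacobson_quot 1.
Definition jq_mul := lift_op2 jacobson_quot *%R.

Lemma jacobson_quot_eq (x y : R) :
  (\pi_jacobson_quot x = \pi_jacobson_quot y) <-> jacobson R (x - y).
Proof.
split=> [/eqP|Jxy].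
  by rewrite -Quotient.idealrBE => /asboolP.
by apply/eqP; rewrite -Quotient.idealrBE; exact/asboolP.
Qed.

Lemma jq_pi_one : \pi_jacobson_quot 1 = jq_one.
Proof. by rewrite /jq_one -lock. Qed.

Lemma jq_pi_mul : {morph \pi_jacobson_quot : x y / x * y >-> jq_mul x y}.
Proof.
move=> x y; rewrite /jq_mul -lock; apply/jacobson_quot_eq.
have [[_ JD JM] [_ _ JMr]] := jacobson_two_sided.
have repJ z : jacobson R (z - repr (\pi_jacobson_quot z)).
  by apply/jacobson_quot_eq; rewrite reprK.
set x' := repr _; set y' := repr _.
have -> : x * y - x' * y' = (x - x') * y + x' * (y - y').
  by rewrite mulrBl mulrBr addrA subrK.
by apply: JD; [apply: JMr|apply: JM]; exact: repJ.
Qed.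

Lemma jq_mulA : associative jq_mul.
Proof.
by elim/quotW=> x; elim/quotW=> y; elim/quotW=> z; rewrite -!jq_pi_mul mulrA.
Qed.

Lemma jq_mul1 : left_id jq_one jq_mul.
Proof. by elim/quotW=> x; rewrite -jq_pi_one -jq_pi_mul mul1r. Qed.

Lemma jq_mulr1 : right_id jq_one jq_mul.
Proof. by elim/quotW=> x; rewrite -jq_pi_one -jq_pi_mul mulr1. Qed.

Lemma jq_pi_add (x y : R) : \pi_jacobson_quot (x + y) =
  \pi_jacobson_quot x + \pi_jacobson_quot y.
Proof. exact: Quotient.pi_add. Qed.

Lemma jq_mulDl : left_distributive jq_mul +%R.
Proof.
elim/quotW=> x; elim/quotW=> y; elim/quotW=> z.
by rewrite -jq_pi_add -!jq_pi_mul -jq_pi_add mulrDl.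
Qed.

Lemma jq_mulDr : right_distributive jq_mul +%R.
Proof.
elim/quotW=> x; elim/quotW=> y; elim/quotW=> z.
by rewrite -jq_pi_add -!jq_pi_mul -jq_pi_add mulrDr.
Qed.

HB.instance Definition _ := GRing.Zmodule_isPzRing.Build jacobson_quot
  jq_mulA jq_mul1 jq_mulr1 jq_mulDl jq_mulDr.

End JacobsonIdeal.

Arguments jacobson_quot : clear implicits.

Section RingClasses.
Variable R : pzRingType.
Implicit Types I K : set R.

Definition left_artinian : Prop :=
  forall I_ : nat -> set R, (forall n, left_ideal (I_ n)) ->
    (forall n, I_ n.+1 `<=` I_ n) ->
  exists n, forall m, (n <= m)%N -> I_ m = I_ n.

Definition right_artinian : Prop :=
  forall I_ : nat -> set R, (forall n, right_ideal (I_ n)) ->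
    (forall n, I_ n.+1 `<=` I_ n) ->
  exists n, forall m, (n <= m)%N -> I_ m = I_ n.

Definition artinian : Prop := left_artinian /\ right_artinian.

(* R is semisimple as a left module over itself: every submodule of the left
   regular module, i.e. every left ideal, is a direct summand. *)
Definition semisimple : Prop :=
  forall I, left_ideal I -> exists K, [/\ left_ideal K,
    I `&` K = [set 0] & forall x, exists y z, [/\ I y, K z & x = y + z]].

Definition semisimple_artinian : Prop := semisimple /\ artinian.

Definition simple_ring : Prop :=
  (1 : R) <> 0 /\
  forall I, two_sided_ideal I -> I = [set 0] \/ I = setT.

Definition simple_artinian : Prop := simple_ring /\ artinian.

Definition Delta : set R :=
  [set a | forall u : R, is_unit u -> is_unit (1 - u * a)].

Definition sqrt_Delta : set R :=
  [set x | exists m : nat, (1 <= m)%N /\ Delta (x ^+ m)].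

Definition sqrt_Delta_fine_elt (r : R) : Prop :=
  r <> 0 /\ exists u a : R, [/\ is_unit u, sqrt_Delta a & r = u + a].

Definition sqrt_Delta_fine : Prop :=
  forall r : R, r <> 0 -> sqrt_Delta_fine_elt r.

End RingClasses.

Arguments left_artinian : clear implicits.
Arguments right_artinian : clear implicits.
Arguments artinian : clear implicits.
Arguments semisimple : clear implicits.
Arguments semisimple_artinian : clear implicits.
Arguments simple_ring : clear implicits.
Arguments simple_artinian : clear implicits.
Arguments Delta : clear implicits.
Arguments sqrt_Delta : clear implicits.
Arguments sqrt_Delta_fine : clear implicits.

Definition semi_local (R : pzRingType) : Prop :=
  semisimple_artinian (jacobson_quot R).

(* Main.v *)
(* A nonzero element of a proper two-sided ideal is never sqrt-Delta-fine, so a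
   sqrt-Delta-fine ring is simple; then J(R) = 0 and R = R/J(R) is Artinian.
   Conversely let R be simple Artinian, e an idempotent with R e minimal, and let
   a nonzero r act on the right of the vector space e R over the division ring
   e R e. If some v has v r outside the line of v, complete v and v r to a basis
   with v first and v r last: there r is an invertible matrix plus a strictly
   triangular one. Otherwise r is injective, hence a unit. *)

Require Import Defs.
From mathcomp Require Import all_boot all_algebra.
From mathcomp Require Import boolp classical_sets.

Set Implicit Arguments.
Unset Strict Implicit.
Unset Printing Implicit Defensive.

Import GRing.Theory.

Local Open Scope classical_set_scope.
Local Open Scope quotient_scope.
Local Open Scope ring_scope.

(** * Units, [Delta] and two-sided ideals *)

Section Units.
Variable R : pzRingType.
Implicit Types u x : R.

Lemma is_unit_exp u n : is_unit u -> is_unit (u ^+ n).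
Proof.
move=> [v [vu uv]]; exists (v ^+ n).
have cuv : GRing.comm v u by rewrite /GRing.comm vu uv.
by rewrite -!exprMn_comm ?vu ?uv ?expr1n.
Qed.

Lemma is_unitN u : is_unit u -> is_unit (- u).
Proof. by move=> [v [vu uv]]; exists (- v); rewrite !mulrNN. Qed.

Lemma Delta0 : Delta R 0.
Proof. by move=> u _; rewrite mulr0 subr0; exists 1; rewrite mul1r. Qed.

Lemma left_ideal_unit (I : set R) u : left_ideal I -> is_unit u -> I u -> I = setT.
Proof.
move=> [_ _ IM] [v [vu _]] Iu; apply/seteqP; split=> // x _.
by rewrite -[x]mulr1 -vu mulrA; exact: IM.
Qed.

Lemma two_sided_ideal_exp_congr (I : set R) x y n :
  two_sided_ideal I -> I (x - y) -> I (x ^+ n - y ^+ n).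
Proof.
move=> [[I0 ID IMl] [_ _ IMr]] Ixy; elim: n => [|n IHn]; first by rewrite subrr.
rewrite !exprS.
have -> : x * x ^+ n - y * y ^+ n = (x - y) * x ^+ n + y * (x ^+ n - y ^+ n).
  by rewrite mulrBl mulrBr addrA subrK.
by apply: ID; [exact: IMr|exact: IMl].
Qed.

(* If [r = u + a] lies in an ideal then [a = - u] modulo it, so that
   [1 - (- u) ^- m * a ^+ m] is a unit belonging to the ideal. *)
Lemma sqrt_Delta_fine_ideal (I : set R) r :
  two_sided_ideal I -> I r -> sqrt_Delta_fine_elt r -> I = setT.
Proof.
move=> tI Ir [_ [u [a [uu [m [_ Da]] rE]]]].
have [lI _] := tI.
have [w [wu uw]] := is_unit_exp m (is_unitN uu).
have uw' : is_unit w by exists ((- u) ^+ m).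
apply: (left_ideal_unit lI (Da w uw')).
have : I (a ^+ m - (- u) ^+ m).
  by apply: two_sided_ideal_exp_congr => //; rewrite opprK addrC -rE.
move: lI => lI /(left_idealN lI); case: lI => _ _ IM /(IM w).
by rewrite opprB mulrBr wu.
Qed.

End Units.

(** * Chain conditions and semisimplicity under surjections *)

Section Transport.
Variables (R S : pzRingType) (f : R -> S).
Hypotheses (fD : {morph f : x y / x + y}) (fM : {morph f : x y / x * y}).
Hypothesis f_surj : forall s, exists x, f x = s.

Let f0 : f 0 = 0.
Proof. by apply: (addrI (f 0)); rewrite -fD !addr0. Qed.

Lemma left_ideal_preimage (I : set S) : left_ideal I -> left_ideal (f @^-1` I).
Proof.
move=> [I0 ID IM]; split=> [|x y|a x]; rewrite /preimage /= ?f0 ?fD ?fM //.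
- exact: ID.
- exact: IM.
Qed.

Lemma right_ideal_preimage (I : set S) : right_ideal I -> right_ideal (f @^-1` I).
Proof.
move=> [I0 ID IM]; split=> [|x y|a x]; rewrite /preimage /= ?f0 ?fD ?fM //.
- exact: ID.
- exact: IM.
Qed.

Lemma preimage_surj_inj (I K : set S) : f @^-1` I = f @^-1` K -> I = K.
Proof.
move=> IK; apply/seteqP; split=> s; have [x <-] := f_surj s.
- by move=> Ix; have : (f @^-1` I) x by []; rewrite IK.
- by move=> Kx; have : (f @^-1` K) x by []; rewrite -IK.
Qed.

(** Chains of ideals pull back along [f], and surjectivity makes the pullback injective on sets, so
    stabilisation in [R] descends to [S]. *)
Lemma artinian_surj : artinian R -> artinian S.
Proof.
move=> [lR rR]; split=> I_ idI decI.
- have [|n x|n nP] := lR (fun n => f @^-1` I_ n).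
  + by move=> n; exact: left_ideal_preimage.
  + exact: decI.
  + by exists n => m /nP /preimage_surj_inj.
- have [|n x|n nP] := rR (fun n => f @^-1` I_ n).
  + by move=> n; exact: right_ideal_preimage.
  + exact: decI.
  + by exists n => m /nP /preimage_surj_inj.
Qed.

(** The image of a complement [K] of the preimage of [I] works: if [x] is in [K] and [f x] in [I],
    then [x] is in both summands, so [x = 0]. *)
Lemma semisimple_surj : semisimple R -> semisimple S.
Proof.
move=> ssR I lI.
have [K [[K0 KD KM] IK0 IK]] := ssR _ (left_ideal_preimage lI).
exists (f @` K); split.
- split=> [|_ _ [x Kx <-] [y Ky <-]|a _ [x Kx <-]].
  + by exists 0.
  + by exists (x + y); [exact: KD|exact: fD].
  + by have [b <-] := f_surj a; exists (b * x); [exact: KM|exact: fM].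
- apply/seteqP; split=> [s [Is [x Kx xE]]|_ ->].
  + have : (f @^-1` I `&` K) x by split=> //; rewrite /preimage /= xE.
    by rewrite -xE IK0 => ->; exact: f0.
  + by split; [case: lI|exists 0].
- move=> s; have [x <-] := f_surj s; have [y [z [Iy Kz ->]]] := IK x.
  by exists (f y), (f z); split=> //; exists z.
Qed.

End Transport.

(** * Maximal left ideals and the quotient by the Jacobson radical *)

Section Jacobson.
Variable R : nzRingType.

Lemma exists_maximal_left_ideal : exists M : set R, maximal_left_ideal M.
Proof.
pose P (I : set R) := I `<=` set0 \/ left_ideal I /\ ~ I 1.
have [|A [PA maxA]] := @Zorn_bigcup _ P.
  move=> F FP totF.
  have [F0|/existsNP[I0 /not_implyP[FI0 nI0]]] :=
      pselect (forall I, F I -> I `<=` set0).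
    by left=> x [I /F0]; apply.
  have lF I x : F I -> I x -> left_ideal I /\ ~ I 1.
    by move=> /FP[+ Ix|//] => /(_ x Ix).
  have [x0 I0x0] : exists x, I0 x by apply/not_existsP => n; apply: nI0 => x /n.
  right; split; last by move=> [I FI I1]; case: (lF _ _ FI I1).
  split.
  - by exists I0 => //; case: (lF _ _ FI0 I0x0) => -[].
  - move=> x y [I FI Ix] [K FK Ky].
    have [[_ ID _] _] := lF _ _ FI Ix; have [[_ KD _] _] := lF _ _ FK Ky.
    by have [IK|KI] := totF _ _ FI FK; [exists K; auto|exists I; auto].
  - by move=> a x [I FI Ix]; exists I => //; case: (lF _ _ FI Ix) => -[_ _]; auto.
have l0 : left_ideal [set (0 : R)].
  by split=> // [x y -> ->|a x ->]; rewrite ?addr0 ?mulr0.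
have [lA nA1] : left_ideal A /\ ~ A 1.
  case: PA => // A0; exfalso; apply: (maxA [set 0]).
    by split=> [x /A0|/(_ 0 erefl)/A0].
  by right; split=> // /eqP; rewrite oner_eq0.
exists A; split=> // [A_T|I lI AI]; first by apply: nA1; rewrite A_T.
have [I1|nI1] := pselect (I 1).
  by right; apply: (left_ideal_unit lI _ I1); exists 1; rewrite mul1r.
left; apply/seteqP; split=> //; apply: contrapT => nIA.
by apply: (maxA I); [split|right].
Qed.

Lemma jacobson_proper : jacobson R <> setT.
Proof.
have [M maxM] := exists_maximal_left_ideal; have [lM MT _] := maxM.
move=> JT; apply: MT; apply/seteqP; split=> // x _.
have Jx : jacobson R x by rewrite JT.
exact: Jx.
Qed.

Lemma simple_jacobson : simple_ring R -> jacobson R = [set 0].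
Proof. by move=> [_ /(_ _ (@jacobson_two_sided R))[//|/jacobson_proper]]. Qed.

Lemma pi_jacobson_surj (s : jacobson_quot R) : exists x : R, \pi_(jacobson_quot R) x = s.
Proof. by exists (repr s); rewrite reprK. Qed.

Lemma jacobson_quot_artinian : artinian R -> artinian (jacobson_quot R).
Proof.
apply: (@artinian_surj R (jacobson_quot R) (\pi_(jacobson_quot R))).
- exact: jq_pi_add.
- exact: jq_pi_mul.
- exact: pi_jacobson_surj.
Qed.

Lemma jacobson_quot_semisimple : semisimple R -> semisimple (jacobson_quot R).
Proof.
apply: (@semisimple_surj R (jacobson_quot R) (\pi_(jacobson_quot R))).
- exact: jq_pi_add.
- exact: jq_pi_mul.
- exact: pi_jacobson_surj.
Qed.

(** When the radical is zero the projection is injective, so [repr] is additive, multiplicative and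
    onto. *)
Lemma artinian_jacobson_quot :
  jacobson R = [set 0] -> artinian (jacobson_quot R) -> artinian R.
Proof.
move=> J0; have pi_inj (x y : R) :
    \pi_(jacobson_quot R) x = \pi_(jacobson_quot R) y -> x = y.
  by move/jacobson_quot_eq; rewrite J0 => /eqP; rewrite subr_eq0 => /eqP.
apply: (@artinian_surj (jacobson_quot R) R repr).
- by move=> s t; apply: pi_inj; rewrite jq_pi_add !reprK.
- by move=> s t; apply: pi_inj; rewrite jq_pi_mul !reprK.
- by move=> x; exists (\pi_(jacobson_quot R) x); apply: pi_inj; rewrite reprK.
Qed.

Lemma sqrt_Delta_fine_simple : sqrt_Delta_fine R -> simple_ring R.
Proof.
move=> fineR; split; first by apply/eqP; rewrite oner_eq0.
move=> I tI.
have [[r [Ir /fineR fr]]|nI] := pselect (exists r, I r /\ r <> 0).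
  by right; exact: sqrt_Delta_fine_ideal fr.
left; apply/seteqP; split=> [x Ix|_ ->]; last by case: tI => -[].
by apply: contrapT => x0; apply: nI; exists x.
Qed.

End Jacobson.

(** * Minimal left ideals and units in left Artinian rings *)

Section LeftArtinian.
Variable R : pzRingType.
Implicit Types (I K L : set R) (x y z : R).

Lemma left_ideal_principal x : left_ideal [set y | exists a, y = a * x].
Proof.
split=> /=; first by exists 0; rewrite mul0r.
- by move=> _ _ [a ->] [b ->]; exists (a + b); rewrite mulrDl.
- by move=> a _ [b ->]; exists (a * b); rewrite mulrA.
Qed.

Lemma left_ideal_mulr L x : left_ideal L -> left_ideal [set z | exists2 y, L y & z = y * x].
Proof.
move=> [L0 LD LM]; split=> /=; first by exists 0; rewrite ?mul0r.
- by move=> _ _ [y Ly ->] [z Lz ->]; exists (y + z); rewrite ?mulrDl //; exact: LD.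
- by move=> a _ [y Ly ->]; exists (a * y); rewrite ?mulrA //; exact: LM.
Qed.

(** Without a minimal member, choice produces a strictly decreasing sequence in [P] starting from
    [I0]. *)
Lemma left_artinian_min (P : set (set R)) I0 : left_artinian R ->
  (forall I, P I -> left_ideal I) -> P I0 ->
  exists2 I, P I & forall K, P K -> K `<=` I -> K = I.
Proof.
move=> artR lP PI0; apply: contrapT => noMin.
have next (I : {I | P I}) :
    exists K : {I | P I}, sval K `<=` sval I /\ sval K <> sval I.
  apply: contrapT => nK; apply: noMin; exists (sval I); first exact: svalP.
  move=> K PK KI; apply: contrapT => KnI; apply: nK.
  by exists (exist _ K PK).
have [g gP] := choice next.
pose I_ n := sval (iter n g (exist _ I0 PI0)).
have [n|n|n nP] := artR I_.
- exact/lP/svalP.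
- by have [] := gP (iter n g (exist _ I0 PI0)).
- by have [_] := gP (iter n g (exist _ I0 PI0)); apply; exact: (nP n.+1).
Qed.

Lemma left_artinian_exp x : left_artinian R -> exists n a, x ^+ n = a * x ^+ n.+1.
Proof.
move=> artR; have [n|n|n nP] := artR (fun n => [set y | exists a, y = a * x ^+ n]).
- exact: left_ideal_principal.
- by move=> _ [a ->]; exists (a * x); rewrite exprS mulrA.
- exists n; have : [set y | exists a, y = a * x ^+ n] (x ^+ n) by exists 1; rewrite mul1r.
  by rewrite -(nP n.+1).
Qed.

(** From [y ^+ n = a * y ^+ n.+1], cancelling powers of [y] by powers of [u] on the right gives
    [a * y = 1]; then [a = u]. *)
Lemma left_artinian_unitl u y : left_artinian R -> y * u = 1 -> is_unit u.
Proof.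
move=> artR yu; have yun n : y ^+ n * u ^+ n = 1.
  elim: n => [|n IHn]; first by rewrite mul1r.
  by rewrite exprSr exprS -mulrA (mulrA y) yu mul1r.
have [n [a ya]] := left_artinian_exp y artR.
have ay : a * y = 1 by rewrite -(yun n) ya exprS -!mulrA yun mulr1.
by exists y; split=> //; rewrite -[u]mul1r -ay -(mulrA a) yu mulr1.
Qed.

(** From [x ^+ n = a * x ^+ n.+1] one gets [(1 - a * x) * x ^+ n = 0], and [x ^+ n] can be
    cancelled. *)
Lemma left_artinian_regular_unit x : left_artinian R ->
  (forall y, y * x = 0 -> y = 0) -> is_unit x.
Proof.
move=> artR regx; have [n [a xa]] := left_artinian_exp x artR.
apply: (@left_artinian_unitl x a artR).
have regxn y : y * x ^+ n = 0 -> y = 0.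
  elim: n y {xa} => [|n IHn] y; first by rewrite mulr1.
  by rewrite exprS mulrA => /IHn /regx.
apply/eqP; rewrite -subr_eq0; apply/eqP/regxn.
by rewrite mulrBl mul1r -mulrA -exprS -xa subrr.
Qed.

End LeftArtinian.

(** * Dual systems and the unit plus nilpotent decomposition *)

(* A basis [v 0, ..., v n.-1] of the left [e R e]-module [e R] (when complete)
   together with its dual basis in [R e]. *)
Definition dual_system (R : pzRingType) (e : R) n (v w : nat -> R) : Prop :=
  [/\ forall i, (i < n)%N -> e * v i = v i,
      forall i, (i < n)%N -> w i * e = w i &
      forall i j, (i < n)%N -> (j < n)%N -> v i * w j = e *+ (i == j)].

(* In the basis [v] the nilpotent [N] is strictly lower triangular; it is
   chosen so that [v i.+1 * (r - N)] is [v i] plus a combination of the [v j],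
   [j > i], which makes [r - N] invertible since [v 0 * (r - N) = v n]. *)
Lemma dual_system_unit_nilpotent (R : pzRingType) (e r : R) n v w :
  dual_system e n.+1 v w -> \sum_(0 <= i < n.+1) w i * v i = 1 ->
  v 0%N * r = v n ->
  exists N y : R, N ^+ n.+1 = 0 /\ y * (r - N) = 1.
Proof.
move=> [ev we vw] wv1 v0r.
pose g k := if k is i.+1 then
  \sum_(0 <= j < i.+1) v i.+1 * r * w j * v j - v i else 0.
pose N := \sum_(0 <= i < n.+1) w i * g i.
have eg k : (k <= n)%N -> e * g k = g k.
  case: k => [|k] kn; first by rewrite mulr0.
  rewrite /g mulrBr mulr_sumr ev 1?ltnW //; congr (_ - _).
  by apply: eq_bigr => j _; rewrite !mulrA ev.
have vN k : (k <= n)%N -> v k * N = g k.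
  move=> kn; rewrite /N mulr_sumr big_mkord.
  rewrite (bigD1 (Ordinal (kn : (k < n.+1)%N))) //= mulrA vw // eqxx eg //.
  rewrite big1 ?addr0 // => i ik; rewrite mulrA vw // eq_sym.
  by move: ik; rewrite -val_eqE /= => /negPf ->; rewrite mul0r.
(* [v k * N] is a combination of the [v j] with [j < k], so each factor [N] lowers the index. *)
have vNm m : forall k, (k < m)%N -> (k <= n)%N -> v k * N ^+ m = 0.
  elim: m => // m IHm [|k] km kn; rewrite exprS mulrA vN //= ?mul0r //.
  rewrite mulrBl (IHm k km (ltnW kn)) subr0 mulr_suml big_nat big1 // => j /andP[_ jk].
  have jk' : (j <= k)%N by rewrite -ltnS.
  by rewrite -mulrA IHm ?mulr0 ?(leq_ltn_trans jk') // (leq_trans jk' (ltnW kn)).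
have vE x : x = \sum_(0 <= j < n.+1) x * w j * v j.
  by rewrite -[LHS]mulr1 -wv1 mulr_sumr; apply: eq_bigr => j _; rewrite mulrA.
(* It suffices that the left ideal [J] generated by [r - N] contains every [v i], since [1] is the
   sum of the [w i * v i]. *)
have [J0 JD JM] := left_ideal_principal (r - N).
set J := [set _ | _] in J0 JD JM.
have Jsum (m p : nat) (F : nat -> R) :
    (forall j, (m <= j < p)%N -> J (F j)) -> J (\sum_(m <= j < p) F j).
  by move=> JF; rewrite big_nat; apply: big_ind.
have JU k : J (v k * (r - N)) by exists (v k).
(* Descending induction on [i], with [k] bounding the distance to [n]. It starts from
   [v n = v 0 * (r - N)], as [g 0 = 0]. *)
have Jv k : forall i, (n <= i + k)%N -> (i <= n)%N -> J (v i).
  elim: k => [|k IHk] i ni i_n.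
    have -> : i = n by apply/eqP; rewrite eqn_leq i_n -[i]addn0.
    by have := JU 0%N; rewrite mulrBr vN //= subr0 v0r.
  have [/IHk|] := leqP n (i + k); first exact.
  move=> ikn; have in_ : (i < n)%N by apply: leq_ltn_trans ikn; exact: leq_addr.
  have : J (v i.+1 * (r - N)) by [].
  rewrite mulrBr vN //= {1}[v i.+1 * r]vE (@big_cat_nat _ _ _ i.+1) //=.
  rewrite opprB [X in J X]addrC addrA subrK.
  move=> Jvi; rewrite -[v i](addrK (\sum_(i.+1 <= j < n.+1) v i.+1 * r * w j * v j)).
  apply: JD => //; apply: (left_idealN (left_ideal_principal _)).
  apply: Jsum => j /andP[ij jn]; apply: JM; apply: IHk => //.
  by rewrite (leq_trans ni) // addnS -addSn leq_add2r.
have [y yE] : J 1.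
  rewrite -wv1; apply: Jsum => j /andP[_ jn]; apply: JM.
  by apply: (Jv n) => //; exact: leq_addl.
exists N, y; split=> //.
rewrite -[LHS]mul1r -wv1 mulr_suml big_nat big1 // => j /andP[_ jn].
by rewrite -mulrA vNm // mulr0.
Qed.

(** * Simple left Artinian rings: minimal idempotents and semisimplicity *)

Section SimpleArtinian.
Variable R : pzRingType.
Hypotheses (simpleR : simple_ring R) (artR : left_artinian R).
Implicit Types (I K L : set R) (x y z : R).

(** The [z] with [x R z = 0] form a two-sided ideal; if it contained [y] it would be all of [R],
    forcing [x = 0]. *)
Lemma simple_prime x y : x <> 0 -> y <> 0 -> exists s, x * s * y <> 0.
Proof.
move=> x0 y0; apply/existsNP => xRy.
pose I : set R := [set z | forall s, x * s * z = 0].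
have tI : two_sided_ideal I.
  split; split=> [s|z t Iz It s|a z Iz s]; rewrite ?mulr0 ?mulrDr ?Iz ?It ?addr0 //.
    by rewrite mulrA -(mulrA x) Iz.
  by rewrite mulrA Iz mul0r.
case: simpleR => _ /(_ I tI)[I0|IT].
  by apply: y0; have : I y by []; rewrite I0.
have I1 : I 1 by rewrite IT.
by apply: x0; rewrite -[x]mulr1 -[LHS]mulr1.
Qed.

(** Brauer's lemma: for a minimal left ideal [M] and [y] in [M] with [M y = M], the [e] in [M] with
    [y = e * y] is idempotent, since [e * e - e] lies in the annihilator of [y] in [M], which is
    zero by minimality. The last clause is minimality of [R e]. *)
Lemma exists_minimal_idempotent L x : left_ideal L -> L x -> x <> 0 ->
  exists e, [/\ L e, e <> 0, e * e = e &
    forall y, y * e = y -> y <> 0 -> exists a, e = a * y].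
Proof.
move=> lL Lx x0.
have [|M [lM ML [{Lx x0}x Mx x0]] minM] :=
    @left_artinian_min R (fun K => [/\ left_ideal K, K `<=` L & exists2 z, K z & z <> 0])
      L artR (fun K '(And3 lK _ _) => lK).
  by split=> //; exists x.
have {}minM K : left_ideal K -> K `<=` M -> (exists2 z, K z & z <> 0) -> K = M.
  by move=> lK KM zK; apply: minM => //; split=> // z /KM /ML.
have [s xsx] := simple_prime x0 x0; have [M0 MD MM] := lM.
pose y := s * x; have My : M y by exact: MM.
have xy : x * y <> 0 by rewrite mulrA.
have MyE : [set z | exists2 t, M t & z = t * y] = M.
  apply: minM; first exact: left_ideal_mulr.
    by move=> _ [t _ ->]; exact: MM.
  by exists (x * y) => //; exists x.
have [e Me ye] : [set z | exists2 t, M t & z = t * y] y by rewrite MyE.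
have y0 : y <> 0 by move=> y0; apply: xy; rewrite y0 mulr0.
have e0 : e <> 0 by move=> e0; apply: y0; rewrite ye e0 mul0r.
exists e; split=> //; first exact: ML.
- apply: contrapT => ee.
  have KM : [set z | M z /\ z * y = 0] = M.
    apply: minM => [|z []//|].
      split=> [|z t [Mz zy] [Mt ty]|a z [Mz zy]] /=.
      + by rewrite mul0r.
      + by rewrite mulrDl zy ty addr0; split=> //; exact: MD.
      + by rewrite -mulrA zy mulr0; split=> //; exact: MM.
    exists (e * e - e).
      split; first by apply: MD; [exact: MM|exact: left_idealN].
      by rewrite mulrBl -mulrA -!ye subrr.
    by apply/eqP; rewrite subr_eq0; apply/eqP.
  by have : M e by []; rewrite -KM => -[_ ey]; apply: y0; rewrite ye.
- move=> z ze z0.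
  have zM : [set t | exists a, t = a * z] = M.
    apply: minM; first exact: left_ideal_principal.
      by move=> _ [a ->]; apply: (MM); rewrite -ze; exact: MM.
    by exists z => //; exists 1; rewrite mul1r.
  by have : M e by []; rewrite -zM.
Qed.

(* A left ideal [K] minimal among those with [I + K = R] is a complement: an
   idempotent [e] of [I `&` K] could be removed by passing to [K (1 - e)]. *)
Lemma simple_left_artinian_semisimple : semisimple R.
Proof.
move=> I lI; have [I0 ID IM] := lI.
pose P K := left_ideal K /\ forall x, exists y z, [/\ I y, K z & x = y + z].
have [||K [lK IK] minK] := @left_artinian_min R P setT artR; first by move=> K [].
  by split=> [|x]; [split|exists 0, x; rewrite add0r].
have [K0 KD KM] := lK.
exists K; split=> //; apply/seteqP; split=> [x [Ix Kx]|_ ->] //.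
apply: contrapT => x0.
have [|e [[Ie Ke] e0 ee _]] := @exists_minimal_idempotent (I `&` K) x _ (conj Ix Kx) x0.
  split=> [//|y z [Iy Ky] [Iz Kz]|a y [Iy Ky]].
    by split; [exact: ID|exact: KD].
  by split; [exact: IM|exact: KM].
(* Splitting [k = k * e + k * (1 - e)], the first summand is absorbed by [I]. *)
have KE : [set z | exists2 y, K y & z = y * (1 - e)] = K.
  apply: minK.
    split=> [|z]; first exact: left_ideal_mulr.
    have [y [k [Iy Kk ->]]] := IK z.
    exists (y + k * e), (k * (1 - e)); split; first by apply: ID => //; exact: IM.
      by exists k.
    by rewrite mulrBr mulr1 -addrA (addrC (k * e)) subrK.
  move=> _ [y Ky ->]; rewrite mulrBr mulr1; apply: KD => //.
  by apply: (left_idealN lK); exact: KM.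
have [y _ ey] : [set z | exists2 y, K y & z = y * (1 - e)] e by rewrite KE.
by apply: e0; rewrite -ee {1}ey -mulrA mulrBl mul1r ee subrr mulr0.
Qed.

(** * The vector space [e R] over the division ring [e R e] *)

Section MinimalIdempotent.
Variable e : R.
Hypotheses (e0 : e <> 0) (ee : e * e = e).
Hypothesis mine : forall y, y * e = y -> y <> 0 -> exists a, e = a * y.

(** By primeness some [d = v * s * e] is nonzero, hence invertible in [e R e]; [s * e] times its
    inverse is dual to [v]. *)
Lemma minimal_idempotent_dual v : e * v = v -> v <> 0 ->
  exists w, w * e = w /\ v * w = e.
Proof.
move=> ev v0; have [s d0] := simple_prime v0 e0.
pose d := v * s * e.
have ed : e * d = d by rewrite /d !mulrA ev.
have de : d * e = d by rewrite /d -mulrA ee.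
have corner_inv x : x * e = x -> e * x = x -> x <> 0 ->
    exists y, [/\ y * e = y, e * y = y & y * x = e].
  move=> xe ex x0; have [a ax] := mine xe x0.
  by exists (e * a * e); rewrite -!mulrA ee ex -ax !mulrA ee.
have [d' [d'e ed' d'd]] := corner_inv d de ed d0.
have d'0 : d' <> 0 by move=> d'0; apply: e0; rewrite -d'd d'0 mul0r.
(* A left inverse of [d'] must equal [d], so [d'] is also a right inverse of [d]. *)
have [d'' [d''e ed'' d''d']] := corner_inv d' d'e ed' d'0.
exists (s * e * d'); rewrite -!mulrA d'e; split=> //.
rewrite !mulrA -/d.
by rewrite -ed -d''d' -(mulrA d'') d'd -mulrA ed' d''d'.
Qed.

(** The idempotent [f] measures what the system misses. Choose an extension with [R f] minimal: if
    [f] were nonzero, a further dual pair would shrink [R f] strictly. *)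
Lemma dual_system_complete n v w : dual_system e n v w ->
  exists m v' w', [/\ (n <= m)%N, forall i, (i < n)%N -> v' i = v i,
    dual_system e m v' w' & \sum_(0 <= i < m) w' i * v' i = 1].
Proof.
move=> sysv.
pose ext m v' w' := [/\ (n <= m)%N, forall i, (i < n)%N -> v' i = v i &
  dual_system e m v' w'].
pose f m (v' w' : nat -> R) := 1 - \sum_(0 <= i < m) w' i * v' i.
pose P I := exists m v' w', ext m v' w' /\ I = [set y | exists a, y = a * f m v' w'].
have [||_ [m [v' [w' [[nm vv' [ev we vw]] ->]]]] minP] :=
    @left_artinian_min R P [set y | exists a, y = a * f n v w] artR.
- by move=> _ [m [v' [w' [_ ->]]]]; exact: left_ideal_principal.
- by exists n, v, w.
exists m, v', w'; split=> //.
apply/esym/eqP; rewrite -subr_eq0; apply/eqP; rewrite -/(f m v' w').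
set g := f m v' w' in minP *; apply: contrapT => g0.
have sumv i : (i < m)%N -> v' i * \sum_(0 <= j < m) w' j * v' j = v' i.
  move=> im; rewrite mulr_sumr big_mkord (bigD1 (Ordinal im)) //= mulrA vw // eqxx ev //.
  rewrite big1 ?addr0 // => j ij; rewrite mulrA vw // eq_sym.
  by move: ij; rewrite -val_eqE /= => /negPf ->; rewrite mul0r.
have sumw i : (i < m)%N -> (\sum_(0 <= j < m) w' j * v' j) * w' i = w' i.
  move=> im; rewrite mulr_suml big_mkord (bigD1 (Ordinal im)) //= -mulrA vw // eqxx we //.
  rewrite big1 ?addr0 // => j ij; rewrite -mulrA vw //.
  by move: ij; rewrite -val_eqE /= => /negPf ->; rewrite mulr0.
have vg i : (i < m)%N -> v' i * g = 0.
  by move=> im; rewrite /g /f mulrBr mulr1 sumv // subrr.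
have gw i : (i < m)%N -> g * w' i = 0.
  by move=> im; rewrite /g /f mulrBl mul1r sumw // subrr.
have gg : g * g = g.
  rewrite {1}/g /f mulrBl mul1r mulr_suml big_nat big1 ?subr0 // => i /andP[_ im].
  by rewrite -mulrA vg // mulr0.
have [s esg] := simple_prime e0 g0.
(* Taking the new pair in [e R g] and [g R e] makes it orthogonal to the old system. *)
pose x := e * s * g.
have xg : x * g = x by rewrite /x -mulrA gg.
have ex : e * x = x by rewrite /x !mulrA ee.
have [z0 [z0e xz0]] := minimal_idempotent_dual ex esg.
pose z := g * z0.
have gz : g * z = z by rewrite /z mulrA gg.
have ze : z * e = z by rewrite /z -mulrA z0e.
have xz : x * z = e by rewrite /z mulrA xg.
pose v2 i := if (i < m)%N then v' i else x.
pose w2 i := if (i < m)%N then w' i else z.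
have fE : f m.+1 v2 w2 = g - z * x.
  rewrite /f big_nat_recr //= /v2 /w2 ltnn opprD addrA; congr (_ - _ - _).
  by apply: eq_big_nat => i /andP[_ ->].
have ext2 : ext m.+1 v2 w2.
  split; first exact: leqW.
    by move=> i ni; rewrite /v2 (leq_trans ni nm) vv'.
  rewrite /v2 /w2; split=> [i _|i _|i j].
  - by case: ifP => // im; exact: ev.
  - by case: ifP => // im; exact: we.
  - rewrite !ltnS => im jm; case: ltnP => im'; case: ltnP => jm'.
    + exact: vw.
    + by rewrite -gz mulrA vg // mul0r ltn_eqF // (leq_trans im').
    + by rewrite -xg -mulrA gw // mulr0 gtn_eqF // (leq_trans jm').
    + rewrite xz; suff -> : i = j by rewrite eqxx.
      by apply/eqP; rewrite eqn_leq (leq_trans im jm') (leq_trans jm im').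
have gE : [set y | exists a, y = a * f m.+1 v2 w2] = [set y | exists a, y = a * g].
  apply: minP; first by exists m.+1, v2, w2.
  by move=> _ [a ->]; exists (a * (1 - z * x)); rewrite fE -mulrA mulrBl mul1r -(mulrA z) xg.
have [a ga] : [set y | exists a, y = a * f m.+1 v2 w2] g.
  by rewrite gE; exists 1; rewrite mul1r.
have z_0 : z = 0 by rewrite -gz ga fE -mulrA mulrBl gz -(mulrA z) xz ze subrr mulr0.
by apply: e0; rewrite -xz z_0 mulr0.
Qed.

Lemma exists_dual_system_adapted v r : e * v = v -> (forall c, v * r <> c * v) ->
  exists n b w, [/\ dual_system e n.+1 b w,
    \sum_(0 <= i < n.+1) w i * b i = 1 & b 0%N * r = b n].
Proof.
move=> ev vr.
have v0 : v <> 0 by move=> v0; apply: (vr 0); rewrite v0 !mul0r.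
have [w1 [w1e vw1]] := minimal_idempotent_dual ev v0.
have ev' : e * (v * r) = v * r by rewrite mulrA ev.
(* The part of [v * r] left after subtracting its component along [v]; a dual of [u] yields [w2],
   which vanishes on [v]. *)
pose u := v * r * (1 - w1 * v).
have eu : e * u = u by rewrite /u mulrA ev'.
have u0 : u <> 0.
  rewrite /u mulrBr mulr1 mulrA => /eqP; rewrite subr_eq0 => /eqP; exact: vr.
have [z [ze uz]] := minimal_idempotent_dual eu u0.
pose w2 := (1 - w1 * v) * z.
have v'w2 : v * r * w2 = e by rewrite /w2 mulrA.
have vw2 : v * w2 = 0 by rewrite /w2 mulrA mulrBr mulr1 mulrA vw1 ev subrr mul0r.
have w2e : w2 * e = w2 by rewrite /w2 -mulrA ze.
(* [w1] corrected to vanish on [v * r]. *)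
pose w3 := w1 - w2 * (v * r * w1).
have vw3 : v * w3 = e by rewrite /w3 mulrBr [v * (_ * _)]mulrA vw2 mul0r subr0.
have v'w3 : v * r * w3 = 0.
  by rewrite /w3 mulrBr [v * r * (w2 * _)]mulrA v'w2 [e * _]mulrA ev' subrr.
have w3e : w3 * e = w3 by rewrite /w3 mulrBl -!mulrA w1e.
pose b i := if i == 0%N then v * r else v.
pose c i := if i == 0%N then w2 else w3.
have sys : dual_system e 2 b c.
  split; rewrite /b /c.
  - by move=> [|[|]].
  - by move=> [|[|]].
  - by move=> [|[|//]] [|[|//]].
have [[|n] [b' [c' [n2 bb' [eb ce bc] sum1]]]] := dual_system_complete sys => //.
(* A cyclic shift puts [b' 1 = v] first and [b' 0 = v * r] last. *)
pose b2 i := if (i < n)%N then b' i.+1 else b' 0%N.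
pose c2 i := if (i < n)%N then c' i.+1 else c' 0%N.
have n0 : (0 < n)%N by [].
exists n, b2, c2; split.
- rewrite /b2 /c2; split=> [i _|i _|i j].
  + by case: ifP => im; exact: eb.
  + by case: ifP => im; exact: ce.
  + rewrite !ltnS => im jm; case: ltnP => im'; case: ltnP => jm'; rewrite bc //.
    * by rewrite (@ltn_eqF i j) // (leq_trans im').
    * by rewrite (@gtn_eqF j i) // (leq_trans jm').
    * suff -> : i = j by rewrite !eqxx.
      by apply/eqP; rewrite eqn_leq (leq_trans im jm') (leq_trans jm im').
- rewrite big_nat_recr //= /b2 /c2 ltnn -sum1 big_nat_recl // addrC; congr (_ + _).
  by apply: eq_big_nat => i /andP[_ ->].
- by rewrite /b2 n0 ltnn !bb'.
Qed.

(* If [r] maps every line of [e R] to itself then it acts injectively, since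
   [v r = 0] and [w r <> 0] would make [v + w] span a line not mapped to itself. *)
Lemma minimal_idempotent_scalar_regular r : r <> 0 ->
  (forall v, e * v = v -> exists c, v * r = c * v) -> forall x, x * r = 0 -> x = 0.
Proof.
move=> r0 scalar x xr; apply: contrapT => x0.
have [s v0] := simple_prime e0 x0; have [t wr0] := simple_prime e0 r0.
pose v := e * s * x.
have ev : e * v = v by rewrite /v !mulrA ee.
have vr : v * r = 0 by rewrite /v -mulrA xr mulr0.
have [z [ze vz]] := minimal_idempotent_dual ev v0.
(* [e * t] less its component along [v]: then [w * z = 0], while [w * r] is still [e * t * r]. *)
pose w := e * t - e * t * z * v.
have ew : e * w = w by rewrite /w mulrBr !mulrA ee.
have wr : w * r = e * t * r by rewrite /w mulrBl -[_ * v * r]mulrA vr mulr0 subr0.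
have wz : w * z = 0 by rewrite /w mulrBl -[_ * v * z]mulrA vz -[_ * z * e]mulrA ze subrr.
have [c wc] := scalar w ew.
have evw : e * (v + w) = v + w by rewrite mulrDr ev ew.
have [d vwd] := scalar _ evw.
(* Multiplying [(v + w) * r = d * (v + w)] by [z] isolates the coefficient of [v], and the left side
   [w * r = c * w] is killed. *)
have de : d * e = 0.
  have : (v + w) * r * z = 0 by rewrite mulrDl vr add0r wc -mulrA wz mulr0.
  by rewrite vwd -mulrA mulrDl vz wz addr0.
apply: wr0; rewrite -wr -[w * r]add0r -vr -mulrDl vwd -evw mulrA.
by rewrite de mul0r.
Qed.

Lemma minimal_idempotent_unit_nilpotent r : r <> 0 ->
  exists (N : R) m, is_unit (r - N) /\ N ^+ m.+1 = 0.
Proof.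
move=> r0.
have [[v [ev vr]]|nv] := pselect (exists v, e * v = v /\ forall c, v * r <> c * v).
  have [n [b [w [sys sum1 b0r]]]] := exists_dual_system_adapted ev vr.
  have [N [y [Nn yU]]] := dual_system_unit_nilpotent sys sum1 b0r.
  by exists N, n; split=> //; exact: left_artinian_unitl yU.
exists 0, 0%N; split=> //; rewrite subr0.
apply: left_artinian_regular_unit => //; apply: minimal_idempotent_scalar_regular => //.
by move=> v ev; apply/not_existsP => vr; apply: nv; exists v.
Qed.

End MinimalIdempotent.

Lemma simple_left_artinian_sqrt_Delta_fine : sqrt_Delta_fine R.
Proof.
move=> r r0; split=> //.
have lT : left_ideal [set: R] by split.
have [e [_ e0 ee mine]] := exists_minimal_idempotent lT Logic.I simpleR.1.
have [N [m [uU Nm]]] := minimal_idempotent_unit_nilpotent e0 ee mine r0.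
exists (r - N), N; split; rewrite ?subrK //.
by exists m.+1; split=> //; rewrite Nm; exact: Delta0.
Qed.

End SimpleArtinian.

Theorem corollary3p10 (R : nzRingType) :
  semi_local R /\ sqrt_Delta_fine R <-> simple_artinian R.
Proof.
split=> [[[_ artRJ] fineR]|[simpleR artR]].
  have simpleR := sqrt_Delta_fine_simple fineR.
  by split=> //; apply: artinian_jacobson_quot artRJ; exact: simple_jacobson.
split; last exact: simple_left_artinian_sqrt_Delta_fine artR.1.
split; last exact: jacobson_quot_artinian.
apply: jacobson_quot_semisimple.
exact: simple_left_artinian_semisimple artR.1.
Qed.
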